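(* Let $\mathcal{X}$ be a finite set with $|\mathcal{X}|\geq 2$ and let $\mathcal{T}$ be a Hausdorff natural topology on $\mathrm{DMC}_{\mathcal{X},\ast}^{(o)}$. Then $(\mathrm{DMC}_{\mathcal{X},\ast}^{(o)},\mathcal{T})$ is not locally compact anywhere, i.e., for every $\hat{W}\in \mathrm{DMC}_{\mathcal{X},\ast}^{(o)}$, there is no compact neighborhood of $\hat{W}$ in $(\mathrm{DMC}_{\mathcal{X},\ast}^{(o)},\mathcal{T})$.
   Context: For finite nonempty sets $\mathcal{X},\mathcal{Y}$, $\mathrm{DMC}_{\mathcal{X},\mathcal{Y}}$ is the set of channels from $\mathcal{X}$ to $\mathcal{Y}$, i.e. functions $W:\mathcal{X}\times\mathcal{Y}\to[0,1]$, written $W(y|x)$, with $\sum_{y\in\mathcal{Y}}W(y|x)=1$ for every $x\in\mathcal{X}$. It carries the topology inherited from the Euclidean topology of $\mathbb{R}^{\mathcal{X}\times\mathcal{Y}}$. For $W\in\mathrm{DMC}_{\mathcal{X},\mathcal{Y}}$ and $V\in\mathrm{DMC}_{\mathcal{Y},\mathcal{Z}}$, the composition $V\circ W\in\mathrm{DMC}_{\mathcal{X},\mathcal{Z}}$ is $(V\circ W)(z|x)=\sum_{y\in\mathcal{Y}}V(z|y)W(y|x)$. A channel $W'\in\mathrm{DMC}_{\mathcal{X},\mathcal{Z}}$ is degraded from $W\in\mathrm{DMC}_{\mathcal{X},\mathcal{Y}}$ if $W'=V\circ W$ for some $V\in\mathrm{DMC}_{\mathcal{Y},\mathcal{Z}}$;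 $W$ and $W'$ are equivalent if each is degraded from the other. $\mathrm{DMC}_{\mathcal{X},\mathcal{Y}}^{(o)}$ is the quotient of $\mathrm{DMC}_{\mathcal{X},\mathcal{Y}}$ by this equivalence relation, with the quotient topology $\mathcal{T}_{\mathcal{X},\mathcal{Y}}^{(o)}$. Let $[n]=\{1,\dots,n\}$, let $\mathrm{DMC}_{\mathcal{X},\ast}=\coprod_{n\ge1}\mathrm{DMC}_{\mathcal{X},[n]}$, and let $\mathrm{DMC}_{\mathcal{X},\ast}^{(o)}$ be the quotient set of $\mathrm{DMC}_{\mathcal{X},\ast}$ by equivalence of channels. For each $n\geq 1$, $\mathrm{DMC}_{\mathcal{X},[n]}^{(o)}$ is identified with the subset of $\mathrm{DMC}_{\mathcal{X},\ast}^{(o)}$ consisting of the classes containing a channel with output alphabet $[n]$; these subsets increase with $n$ and their union is $\mathrm{DMC}_{\mathcal{X},\ast}^{(o)}$. A topology on $\mathrm{DMC}_{\mathcal{X},\ast}^{(o)}$ is called natural if for every $n\ge1$ the subspace topology it induces on $\mathrm{DMC}_{\mathcal{X},[n]}^{(o)}$ is $\mathcal{T}_{\mathcal{X},[n]}^{(o)}$. A neighborhood of a point is a set containing an open set that contains the point. *)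

(* Defs.v *)
From HB Require Import structures.
From mathcomp Require Import all_boot all_order all_algebra.
From mathcomp Require Import all_classical all_reals all_analysis.

Set Implicit Arguments.
Unset Strict Implicit.
Unset Printing Implicit Defensive.

Import Order.TTheory GRing.Theory Num.Theory.
Import numFieldNormedType.Exports.

Local Open Scope classical_set_scope.
Local Open Scope quotient_scope.
Local Open Scope ring_scope.

Section Channels.
Variable R : realType.

(* W (x, y) is the transition probability W(y|x). As X and Y are finite, the
   product topology on R^(X * Y) is the Euclidean one. *)
Definition is_channel (X Y : finType) : set {ptws (X * Y)%type -> R} :=
  [set W | (forall x y, 0 <= W (x, y) <= 1) /\
           (forall x, \sum_(y : Y) W (x, y) = 1)].

Definition DMC (X Y : finType) : Type := set_type (@is_channel X Y).

HB.instance Definition _ (X Y : finType) :=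
  Topological.copy (DMC X Y) (set_type (@is_channel X Y)).

Definition cond_prob (X Y : finType) (W : DMC X Y) (y : Y) (x : X) : R :=
  set_val W (x, y).

Lemma cond_prob_itv X Y (W : DMC X Y) y x : 0 <= cond_prob W y x <= 1.
Proof. by case: W => W WP; have [W01 _] := set_mem WP; exact: W01. Qed.

Lemma cond_prob_sum X Y (W : DMC X Y) x : \sum_y cond_prob W y x = 1.
Proof. by case: W => W WP; have [_ W1] := set_mem WP; exact: W1. Qed.

Lemma DMC_ext X Y (W W' : DMC X Y) :
  (forall y x, cond_prob W y x = cond_prob W' y x) -> W = W'.
Proof. by move=> WW'; apply/val_inj/funext => -[x y]; exact: WW'. Qed.

Definition compose_fun (X Y Z : finType) (V : DMC Y Z) (W : DMC X Y) :
    {ptws (X * Z)%type -> R} :=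
  fun xz => \sum_(y : Y) cond_prob V xz.2 y * cond_prob W y xz.1.

Lemma compose_channel (X Y Z : finType) (V : DMC Y Z) (W : DMC X Y) :
  compose_fun V W \in @is_channel X Z.
Proof.
apply/mem_set; split=> [x z|x]; last first.
  rewrite exchange_big -[RHS](cond_prob_sum W x); apply: eq_bigr => y _ /=.
  by rewrite -mulr_suml cond_prob_sum mul1r.
have V01 y := cond_prob_itv V z y.
have W01 y := cond_prob_itv W y x.
apply/andP; split.
  by apply: sumr_ge0 => y _; apply: mulr_ge0;
    [case/andP: (V01 y)|case/andP: (W01 y)].
rewrite -(cond_prob_sum W x); apply: ler_sum => y _ /=.
by apply: ler_piMl; [case/andP: (W01 y)|case/andP: (V01 y)].
Qed.

Definition compose (X Y Z : finType) (V : DMC Y Z) (W : DMC X Y) : DMC X Z :=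
  exist _ (compose_fun V W) (compose_channel V W).

Definition degraded (X Y Z : finType) (W' : DMC X Z) (W : DMC X Y) : Prop :=
  exists V : DMC Y Z, W' = compose V W.

Definition equivalent (X Y Z : finType) (W : DMC X Y) (W' : DMC X Z) : Prop :=
  degraded W W' /\ degraded W' W.

Definition identity_fun (Y : finType) : {ptws (Y * Y)%type -> R} :=
  fun yz => (yz.1 == yz.2)%:R.

Lemma identity_channel (Y : finType) : @identity_fun Y \in @is_channel Y Y.
Proof.
apply/mem_set; split=> [y z|y].
  by rewrite /identity_fun/=; case: eqP; rewrite /= ?lexx ler01.
rewrite (bigD1 y)//= {1}/identity_fun/= eqxx big1 ?addr0// => z /negPf zy.
by rewrite /identity_fun/= eq_sym zy.
Qed.

Definition identity (Y : finType) : DMC Y Y :=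
  exist _ (@identity_fun Y) (identity_channel Y).

Lemma cond_prob_compose (X Y Z : finType) (V : DMC Y Z) (W : DMC X Y) z x :
  cond_prob (compose V W) z x = \sum_(y : Y) cond_prob V z y * cond_prob W y x.
Proof. by []. Qed.

Lemma cond_prob_identity (Y : finType) (y z : Y) :
  cond_prob (identity Y) y z = (z == y)%:R.
Proof. by []. Qed.

Lemma degraded_refl (X Y : finType) (W : DMC X Y) : degraded W W.
Proof.
exists (identity Y); apply: DMC_ext => y x.
rewrite cond_prob_compose (bigD1 y)//= cond_prob_identity eqxx mul1r.
rewrite big1 ?addr0// => z /negPf zy.
by rewrite cond_prob_identity zy mul0r.
Qed.

Lemma degraded_trans (X Y Z T : finType)
    (W : DMC X Y) (W' : DMC X Z) (W'' : DMC X T) :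
  degraded W' W -> degraded W'' W' -> degraded W'' W.
Proof.
move=> [V ->] [V' ->]; exists (compose V' V); apply: DMC_ext => t x.
rewrite !cond_prob_compose.
under eq_bigr do rewrite cond_prob_compose mulr_sumr.
rewrite exchange_big; apply: eq_bigr => y _ /=.
rewrite cond_prob_compose mulr_suml.
by apply: eq_bigr => z _; rewrite mulrA.
Qed.

Lemma equivalent_refl (X Y : finType) (W : DMC X Y) : equivalent W W.
Proof. by split; exact: degraded_refl. Qed.

Lemma equivalent_sym (X Y Z : finType) (W : DMC X Y) (W' : DMC X Z) :
  equivalent W W' -> equivalent W' W.
Proof. by case. Qed.

Lemma equivalent_trans (X Y Z T : finType)
    (W : DMC X Y) (W' : DMC X Z) (W'' : DMC X T) :
  equivalent W W' -> equivalent W' W'' -> equivalent W W''.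
Proof.
move=> [WW' W'W] [W'W'' W''W']; split.
  exact: degraded_trans W'W'' WW'.
exact: degraded_trans W'W W''W'.
Qed.

Section Quotient.
Variables X Y : finType.

Definition equivb : rel (DMC X Y) := fun W W' => `[< equivalent W W' >].

Lemma equivb_refl : reflexive equivb.
Proof. by move=> W; apply/asboolP; exact: equivalent_refl. Qed.

Lemma equivb_sym : symmetric equivb.
Proof.
by move=> W W'; apply/asboolP/asboolP; exact: equivalent_sym.
Qed.

Lemma equivb_trans : transitive equivb.
Proof.
move=> W W' W'' /asboolP h /asboolP h'.
by apply/asboolP; exact: equivalent_trans h h'.
Qed.

Canonical equivb_equiv := EquivRel equivb equivb_refl equivb_sym equivb_trans.

Definition DMCo : Type := quotient_topology {eq_quot equivb}.

HB.instance Definition _ := Topological.copy DMCo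
  (quotient_topology {eq_quot equivb}).
HB.instance Definition _ := Quotient.copy DMCo
  (quotient_topology {eq_quot equivb}).

Lemma DMCo_eqP (W W' : DMC X Y) :
  equivalent W W' <-> \pi_DMCo W = \pi_DMCo W'.
Proof. by split=> [h|/eqmodP/asboolP//]; apply/eqmodP/asboolP. Qed.

End Quotient.

Section Star.
Variable X : finType.

(* The output alphabets [n], n >= 1, are the types 'I_n.+1, n >= 0. *)
Definition DMCs : Type := {n : nat & DMC X 'I_n.+1}.

HB.instance Definition _ := Choice.copy DMCs {n : nat & DMC X 'I_n.+1}.

Definition equivsb : rel DMCs :=
  fun W W' => `[< equivalent (projT2 W) (projT2 W') >].

Lemma equivsb_refl : reflexive equivsb.
Proof. by move=> W; apply/asboolP; exact: equivalent_refl. Qed.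

Lemma equivsb_sym : symmetric equivsb.
Proof.
by move=> W W'; apply/asboolP/asboolP; exact: equivalent_sym.
Qed.

Lemma equivsb_trans : transitive equivsb.
Proof.
move=> W W' W'' /asboolP h /asboolP h'.
by apply/asboolP; exact: equivalent_trans h h'.
Qed.

Canonical equivsb_equiv :=
  EquivRel equivsb equivsb_refl equivsb_sym equivsb_trans.

(* No topology is attached to DMCso: a topology on it is always given as an
   explicit family of open sets. *)
Definition DMCso : Type := {eq_quot equivsb}.

HB.instance Definition _ := Choice.copy DMCso {eq_quot equivsb}.
HB.instance Definition _ := Quotient.copy DMCso {eq_quot equivsb}.

Definition classo (n : nat) (W : DMC X 'I_n.+1) : DMCso :=
  \pi_DMCso (existT _ n W : DMCs).

Lemma classo_eqP (n m : nat) (W : DMC X 'I_n.+1) (W' : DMC X 'I_m.+1) :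
  equivalent W W' <-> classo W = classo W'.
Proof. by split=> [h|/eqmodP/asboolP//]; apply/eqmodP/asboolP. Qed.

Definition DMCso_at (n : nat) : set DMCso :=
  [set w | exists W : DMC X 'I_n.+1, w = classo W].

Definition embedo (n : nat) (w : DMCo X 'I_n.+1) : DMCso := classo (repr w).

Lemma embedo_pi (n : nat) (W : DMC X 'I_n.+1) :
  embedo (\pi_(DMCo X 'I_n.+1) W) = classo W.
Proof. by apply/classo_eqP/DMCo_eqP; rewrite reprK. Qed.

Lemma embedo_inj (n : nat) : injective (@embedo n).
Proof.
move=> v w /classo_eqP/DMCo_eqP; by rewrite !reprK.
Qed.

Lemma range_embedo (n : nat) : range (@embedo n) = DMCso_at n.
Proof.
apply/seteqP; split=> [_ [w _ <-]|_ [W ->]]; first by exists (repr w).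
by exists (\pi_(DMCo X 'I_n.+1) W) => //; exact: embedo_pi.
Qed.

End Star.

End Channels.

Definition is_topology (Q : Type) (T : set_system Q) : Prop :=
  [/\ T set0, T setT, setI_closed T &
      forall F : set_system Q, F `<=` T -> T (\bigcup_(A in F) A)].

Definition topologized (Q : Type) (T : set_system Q) (hT : is_topology T) :
  Type := Q.

Section Topologized.
Variables (Q : choiceType) (T : set_system Q) (hT : is_topology T).

Let topT : T setT. Proof. by case: hT. Qed.

Let topI : setI_closed T. Proof. by case: hT. Qed.

Let top_bigcup (I : Type) (f : I -> set Q) :
  (forall i, T (f i)) -> T (\bigcup_i f i).
Proof.
move=> Tf; case: hT => _ _ _ /(_ (range f)); rewrite bigcup_image; apply.
by move=> _ [i _ <-].
Qed.

HB.instance Definition _ := Choice.copy (topologized hT) Q.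
HB.instance Definition _ :=
  isOpenTopological.Build (topologized hT) topT topI top_bigcup.

Lemma open_topologized : @open (topologized hT) = T.
Proof. by []. Qed.

End Topologized.

(* For each n, the trace of T on DMCso_at n coincides with the quotient
   topology of DMCo X 'I_n.+1, transported along the bijection embedo. *)
Definition natural_topology (R : realType) (X : finType)
    (T : set_system (DMCso R X)) : Prop :=
  forall n : nat,
    [set V `&` @DMCso_at R X n | V in T] =
    [set @embedo R X n @` U | U in @open (DMCo R X 'I_n.+1)].

(* Main.v *)
(* Each DMCso_at n is a continuous image of a compact space, hence closed, and
   by a Baire argument a compact set with nonempty interior is not covered by
   countably many closed sets with empty interior. It remains to see that an
   open V is not contained in DMCso_at n. Its preimage among the channels with
   n + 2 outputs would be open and nonempty, so it would contain a channel W
   whose likelihood ratios W(y|a) / W(y|b), for two fixed inputs a != b, are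
   pairwise distinct. Strict convexity of the square shows that such a W is
   fixed by no stochastic matrix but the identity, so the equivalence of W with
   a channel with n + 1 outputs would factor the identity matrix of size n + 2
   through dimension n + 1. *)
Require Import Defs.
From HB Require Import structures.
From mathcomp Require Import all_boot all_order all_algebra.
From mathcomp Require Import all_classical all_reals all_analysis.
From mathcomp Require Import ring lra.

Set Implicit Arguments.
Unset Strict Implicit.
Unset Printing Implicit Defensive.

Import Order.TTheory GRing.Theory Num.Theory.
Import numFieldNormedType.Exports.

Local Open Scope classical_set_scope.
Local Open Scope ring_scope.

(** * Topological preliminaries *)

Lemma compact_set_type (U : topologicalType) (A : set U) :
  compact A -> compact [set: A].
Proof.
move=> cA; have [[a _]|A0] := pselect ([set: A] !=set0); last first.
  by rewrite (_ : [set: A] = set0) //; [exact: compact0|exact/nonemptyPn].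
(* This map is the identity on [A] and takes the default value [a] outside, so its restriction to
   the subspace [A] is continuous. *)
have -> : [set: A] = valL_ a (@id A) @` A.
  rewrite eqEsubset; split=> // x _; exists (set_val x).
    exact: set_valP.
  exact: (congr1 (@^~ x) (@valLK _ _ a A id)).
apply: continuous_compact => //; apply/subspace_valL_continuousP'.
by move=> x; exact: cvg_id.
Qed.

Lemma ptws_continuous (U : topologicalType) (I : Type) (V : topologicalType)
    (f : U -> {ptws I -> V}) :
  (forall i, continuous (fun u => f u i)) -> continuous f.
Proof.
move=> cf u; apply/cvg_sup => i A [_ [[C oC <-] Cfu] CA].
apply: filterS CA _; apply: (cf i u C).
exact: open_nbhs_nbhs.
Qed.

Section Channels.
Variable R : realType.

(** * Algebra of channels *)

Lemma channel_exists (X Y : finType) (f : X -> Y -> R) :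
  (forall x y, 0 <= f x y) -> (forall x, \sum_y f x y = 1) ->
  exists W : DMC R X Y, forall x y, cond_prob W y x = f x y.
Proof.
move=> f0 f1.
have fP : (fun xy => f xy.1 xy.2) \in @is_channel R X Y.
  apply/mem_set; split=> // x y; rewrite f0 /= -(f1 x) (bigD1 y) //=.
  by rewrite lerDl sumr_ge0.
by exists (@SigSub _ _ _ _ fP).
Qed.

(** The [size p] distinct points [e / i.+2] lie strictly between 0 and [e], too many to be all roots
    of [p]. *)
Lemma nonroot_near0 (p : {poly R}) (e : R) : p != 0 -> 0 < e ->
  exists2 x, 0 < x < e & p.[x] != 0.
Proof.
move=> p0 e0; apply: contrapT => np.
pose s := [seq e / i.+2%:R | i <- iota 0 (size p)].
have sroot : all (root p) s.
  apply/allP => _ /mapP[i _ ->]; apply/negP => /negP nr; apply: np.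
  exists (e / i.+2%:R) => //; rewrite divr_gt0 //=.
  by rewrite ltr_pdivrMr // ltr_pMr // ltr1n.
have us : uniq s.
  rewrite map_inj_uniq ?iota_uniq // => i j.
  by move=> /(mulfI (lt0r_neq0 e0)) /invr_inj /eqP; rewrite eqr_nat => /eqP[].
have := max_poly_roots p0 sroot us.
by rewrite size_map size_iota ltnn.
Qed.

(* With p, q the rows of inputs a and b and r = p / q, invariance under S gives
   the identity \sum_(z, y) S(z|y) q(y) (r(y) - r(z))^2 = 0. *)
Lemma compose_fixed (X Y : finType) (a b : X) (W : DMC R X Y) (S : DMC R Y Y) :
  W = compose S W ->
  (forall y, 0 < cond_prob W y b) ->
  (forall y z, y != z ->
     cond_prob W y a * cond_prob W z b != cond_prob W z a * cond_prob W y b) ->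
  S = identity R Y.
Proof.
move=> WS q0 rneq.
pose p y := cond_prob W y a; pose q y := cond_prob W y b.
pose r y := p y / q y.
have qn0 y : q y != 0 by rewrite gt_eqF //; exact: q0.
have pE y : p y = r y * q y by rewrite divfK.
have Sp z : \sum_y cond_prob S z y * p y = p z.
  by rewrite /p {2}WS cond_prob_compose.
have Sq z : \sum_y cond_prob S z y * q y = q z.
  by rewrite /q {2}WS cond_prob_compose.
have S0 z y : 0 <= cond_prob S z y by case/andP: (cond_prob_itv S z y).
have t0 z y : 0 <= cond_prob S z y * q y * (r y - r z) ^+ 2.
  by rewrite mulr_ge0 ?sqr_ge0 // mulr_ge0 // ltW // q0.
have sum0 : \sum_z \sum_y cond_prob S z y * q y * (r y - r z) ^+ 2 = 0.
  transitivity (\sum_z (\sum_y cond_prob S z y * (q y * r y ^+ 2)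
       - q z * r z ^+ 2)).
    apply: eq_bigr => z _.
    transitivity (\sum_y cond_prob S z y * (q y * r y ^+ 2)
        - 2 * r z * (\sum_y cond_prob S z y * p y)
        + r z ^+ 2 * (\sum_y cond_prob S z y * q y)); last first.
      by rewrite Sp Sq pE; ring.
    rewrite !mulr_sumr -sumrB -big_split /=; apply: eq_bigr => y _.
    by rewrite pE; ring.
  rewrite sumrB exchange_big /=; apply/eqP; rewrite subr_eq0; apply/eqP.
  by apply: eq_bigr => y _; rewrite -mulr_suml cond_prob_sum mul1r.
(* All terms of [sum0] are nonnegative, so each is zero, while [q y] is positive and the ratios [r]
   are distinct. *)
have Soff z y : y != z -> cond_prob S z y = 0.
  move=> yz.
  have /eqP := sum0; rewrite psumr_eq0; last by move=> ? _; exact: sumr_ge0.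
  move=> /allP/(_ z (mem_index_enum _)) /=; rewrite psumr_eq0 //.
  move=> /allP/(_ y (mem_index_enum _)) /=.
  rewrite !mulf_eq0 (negPf (qn0 y)) orbF => /orP[/eqP //|].
  rewrite orbb subr_eq0 /r eqr_div // => /eqP rE.
  by have := rneq _ _ yz; rewrite rE eqxx.
apply: DMC_ext => z y; rewrite cond_prob_identity.
have [<-|/Soff //] := eqVneq y z.
rewrite -(cond_prob_sum S y) (bigD1 y) //= big1 ?addr0 // => z' zy.
by rewrite Soff // eq_sym.
Qed.

(** A rank bound. With rows indexed by inputs, [compose V' V] is the matrix product of [V] by [V'],
    in this order. *)
Lemma compose_eq_identity_leq n m (V : DMC R 'I_n 'I_m) (V' : DMC R 'I_m 'I_n) :
  compose V' V = identity R 'I_n -> (n <= m)%N.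
Proof.
move=> VV.
apply: (@mulmx1_min R _ _ (\matrix_(i, j) cond_prob V j i)
                    (\matrix_(i, j) cond_prob V' j i)).
apply/matrixP => i j; rewrite !mxE.
under eq_bigr do rewrite !mxE mulrC.
by rewrite -cond_prob_compose VV cond_prob_identity.
Qed.

Lemma composeA (X Y Z T : finType) (V' : DMC R Z T) (V : DMC R Y Z)
    (W : DMC R X Y) : compose V' (compose V W) = compose (compose V' V) W.
Proof.
apply: DMC_ext => t x; rewrite !cond_prob_compose.
under eq_bigr do rewrite cond_prob_compose mulr_sumr.
rewrite exchange_big; apply: eq_bigr => y _ /=.
by rewrite cond_prob_compose mulr_suml; apply: eq_bigr => z _; rewrite mulrA.
Qed.

Lemma deterministic_exists (Y Z : finType) (f : Y -> Z) :
  exists V : DMC R Y Z, forall y z, cond_prob V z y = (f y == z)%:R.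
Proof.
apply: channel_exists => [//|y].
rewrite (bigD1 (f y)) //= eqxx big1 ?addr0 // => z /negPf.
by rewrite eq_sym => ->.
Qed.

(** Relabelling the outputs by [f] is undone by [g]. This serves to enlarge the output alphabet
    within a class. *)
Lemma equivalent_embedding (X Y Z : finType) (f : Y -> Z) (g : Z -> Y)
  (fK : cancel f g) (W : DMC R X Y) : exists W' : DMC R X Z, equivalent W W'.
Proof.
have [F FE] := deterministic_exists f; have [G GE] := deterministic_exists g.
exists (compose F W); split; last by exists F.
exists G; rewrite composeA.
suff -> : compose G F = identity R Y.
  apply: DMC_ext => y x; rewrite cond_prob_compose (bigD1 y) //=.
  rewrite cond_prob_identity eqxx mul1r big1 ?addr0 // => z /negPf zy.
  by rewrite cond_prob_identity zy mul0r.
apply: DMC_ext => z y; rewrite cond_prob_compose cond_prob_identity.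
rewrite (bigD1 (f y)) //= FE GE eqxx fK mulr1 big1 ?addr0 // => k /negPf kf.
by rewrite FE eq_sym kf mulr0.
Qed.

(** * Compactness and generic channels *)

Lemma compact_DMC (X Y : finType) : compact [set: DMC R X Y].
Proof.
apply: compact_set_type.
pose E := {ptws (X * Y)%type -> R}.
pose box := [set W : E | forall xy, `[0, 1]%classic (W xy)].
have cbox : compact box.
  apply: (@tychonoff _ (fun=> R) (fun=> `[0, 1]%classic)) => _.
  exact: segment_compact.
apply: (subclosed_compact _ cbox); last first.
  by move=> W [W01 _] [x y] /=; rewrite in_itv /= W01.
have -> : @is_channel R X Y =
    (\bigcap_xy [set W : E | W xy \in `[0, 1]]) `&`
    (\bigcap_x [set W : E | \sum_y W (x, y) = 1]).
  rewrite eqEsubset; split=> W [W01 W1]; split.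
  - by move=> [x y] _ /=; rewrite in_itv /= W01.
  - by move=> x _; exact: W1.
  - by move=> x y; have := W01 (x, y) I; rewrite /= in_itv.
  - by move=> x; exact: W1.
have cproj xy : continuous (fun W : E => W xy).
  exact: (@proj_continuous _ (fun=> R) xy).
apply: closedI; apply: closed_bigI.
  move=> xy _.
  apply: (@preimage_closed _ _ (fun W : E => W xy) `[0, 1]%classic).
    by move=> *; exact: cproj.
  exact: interval_closed.
move=> x _.
apply: (@preimage_closed _ _ (fun W : E => \sum_y W (x, y)) [set 1]).
  move=> W _.
  apply: (@continuous_big _ _ _ _ _ _ _ _ (fun y (W : E) => W (x, y))) => //.
  exact: add_continuous.
exact: closed_eq.
Qed.

(** A point of [A] is moved slightly along the segment towards one channel [G] with the required
    properties; the bad parameters are roots of a nonzero polynomial. *)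
Lemma open_DMC_perturb (X : finType) (n : nat) (a b : X)
    (A : set (DMC R X 'I_n.+1)) :
  a != b -> open A -> A !=set0 ->
  exists2 W, A W &
    (forall y, 0 < cond_prob W y b) /\
    (forall y z, y != z ->
     cond_prob W y a * cond_prob W z b != cond_prob W z a * cond_prob W y b).
Proof.
move=> ab [B oB <-] [W0 /= BW0].
(* After normalization, row [a] is proportional to 1, ..., n+1 and row [b] is uniform, so the ratios
   are distinct. *)
pose w (x : X) (y : 'I_n.+1) : R := if x == a then y.+1%:R else 1.
have w0 x y : 0 < w x y by rewrite /w; case: ifP; rewrite ?ltr0n.
have sw x : 0 < \sum_y w x y.
  by rewrite (bigD1 ord0) //= ltr_pwDl // sumr_ge0 // => y _; exact: ltW.
have [G GE] : exists G : DMC R X 'I_n.+1,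
    forall x y, cond_prob G y x = w x y / \sum_z w x z.
  apply: channel_exists => [x y|x]; first by rewrite divr_ge0 ?ltW.
  by rewrite -mulr_suml divff ?gt_eqF.
have G0 x y : 0 < cond_prob G y x by rewrite GE divr_gt0.
pose path (e : R) : {ptws (X * 'I_n.+1)%type -> R} :=
  fun xy => cond_prob W0 xy.2 xy.1 +
    e * (cond_prob G xy.2 xy.1 - cond_prob W0 xy.2 xy.1).
have cpath : continuous path.
  apply: ptws_continuous => xy e; apply: cvgD; first exact: cvg_cst.
  by apply: cvgM; [exact: cvg_id|exact: cvg_cst].
have path0 : path 0 = set_val W0.
  by apply/funext => -[x y]; rewrite /path mul0r addr0.
have /nbhs_ballP[d /= d0 dB] : nbhs (0 : R) (path @^-1` B).
  by apply: cpath; rewrite path0; exact: open_nbhs_nbhs.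
pose l x y : {poly R} := (cond_prob W0 y x)%:P
  + 'X * (cond_prob G y x - cond_prob W0 y x)%:P.
have lE x y e : (l x y).[e] = path e (x, y).
  by rewrite /l !hornerE.
have minorE y z e : (l a y * l b z - l a z * l b y).[e] =
    path e (a, y) * path e (b, z) - path e (a, z) * path e (b, y).
  by rewrite hornerD hornerN 2!hornerM !lE.
clearbody l.
(* The product of the 2 x 2 minors of rows [a] and [b] along the segment. No factor is the zero
   polynomial, since at 1 the segment reaches [G]. *)
pose P : {poly R} := \prod_(yz | yz.1 != yz.2)
  (l a yz.1 * l b yz.2 - l a yz.2 * l b yz.1).
have P0 : P != 0.
  apply/prodf_neq0 => -[y z] /= yz; apply: contra_neq yz => P0.
  have := congr1 (horner^~ 1) P0.
  rewrite minorE horner0 /path /= !mul1r !subrKC.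
  have wb u : w b u = 1 by rewrite /w eq_sym (negPf ab).
  move=> /eqP; rewrite !GE !wb subr_eq0 => /eqP.
  move/(mulIf (lt0r_neq0 (divr_gt0 ltr01 (sw b)))).
  move/(mulIf (invr_neq0 (lt0r_neq0 (sw a)))) => /eqP.
  by rewrite /w eqxx eqr_nat eqSS => /eqP/val_inj.
(* The bound [d] keeps the channel in [B]; the bound 1 keeps the entries nonnegative, and [e > 0]
   makes them positive through [G]. *)
have [e /andP[e0 ed] Pe] : exists2 e, 0 < e < Num.min 1 d & P.[e] != 0.
  by apply: nonroot_near0; rewrite // lt_min ltr01.
move: ed; rewrite lt_min => /andP[e1 ed].
have [W WE] : exists W : DMC R X 'I_n.+1,
    forall x y, cond_prob W y x = path e (x, y).
  apply: (@channel_exists X 'I_n.+1 (fun x y => path e (x, y))) => [x y|x].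
    have /andP[W00 _] := cond_prob_itv W0 y x.
    have := G0 x y; rewrite /path /=; nra.
  by rewrite big_split /= -mulr_sumr sumrB !cond_prob_sum subrr mulr0 addr0.
have valW : set_val W = path e by apply/funext => -[x y]; exact: WE.
exists W => /=.
  by rewrite valW; apply: dB; rewrite /ball /= sub0r normrN gtr0_norm.
split=> [y|y z yz]; rewrite !WE.
  have /andP[W00 _] := cond_prob_itv W0 y b.
  have := G0 b y; rewrite /path /=; nra.
move: Pe; rewrite /P horner_prod => /prodf_neq0 /(_ (y, z) yz).
by rewrite minorE subr_eq0.
Qed.

(** * Consequences of naturality *)

(** Naturality writes the trace of an open [V] as the image of an open [U] of the quotient; as
    [embedo] is injective, [V] and [U] have the same preimage among channels. *)
Lemma classo_continuous (X : finType) (T : set_system (DMCso R X))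
    (hT : is_topology T) (n : nat) : natural_topology T ->
  continuous (@classo R X n : DMC R X 'I_n.+1 -> topologized hT).
Proof.
move=> natT; apply/continuousP => V TV.
have : [set @embedo R X n @` U | U in @open (DMCo R X 'I_n.+1)]
         (V `&` @DMCso_at R X n).
  by rewrite -natT; exists V.
move=> [U oU UV]; have := oU; rewrite /open /= /quotient_open.
congr open; rewrite eqEsubset; split=> W /= => [UW|VW].
  suff [] : (V `&` @DMCso_at R X n) (classo W) by [].
  by rewrite -UV -embedo_pi; exists (\pi W)%qT.
have : (@embedo R X n @` U) (classo W).
  by rewrite UV; split=> //; exists W.
by move=> [w Uw]; rewrite -embedo_pi => /embedo_inj <-.
Qed.

Lemma DMCso_at_compact (X : finType) (T : set_system (DMCso R X))
    (hT : is_topology T) (n : nat) : natural_topology T ->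
  compact (@DMCso_at R X n : set (topologized hT)).
Proof.
move=> natT; have -> : @DMCso_at R X n = @classo R X n @` setT.
  by rewrite eqEsubset; split=> [w [W ->]|_ [W _ <-]]; exists W.
apply: continuous_compact; last exact: compact_DMC.
exact/continuous_subspaceT/classo_continuous.
Qed.

End Channels.

(** * Baire argument and conclusion *)

(** Only [K] is compact, so the usual nested open sets are built inside [K], where compactness and
    separation give regularity. *)
Lemma compact_not_meager (U : topologicalType) (K : set U) (D : nat -> set U) :
  hausdorff_space U -> compact K -> K^° !=set0 ->
  (forall n, closed (D n)) -> (forall n, (D n)^° = set0) ->
  ~ (K `<=` \bigcup_n D n).
Proof.
move=> hU cK K0 clD D0 KD.
pose good (V : set U) := [/\ open V, V !=set0 & V `<=` K].
have /choice[f fP] (nV : nat * set U) : exists W, good nV.2 ->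
    good W /\ closure W `<=` nV.2 `\` D nV.1.
  case: nV => n V /=.
  have [[oV [v Vv] VK]|] := pselect (good V); last by exists set0.
  have [x [Vx nDx]] : exists x, V x /\ ~ D n x.
    apply: contrapT => nx; suff : (D n)^° v by rewrite D0.
    apply: filterS (open_nbhs_nbhs (conj oV Vv)) => x Vx.
    by apply: contrapT => nDx; apply: nx; exists x.
  have oVD : open (V `\` D n).
    by rewrite setDE; apply: openI => //; exact: closed_openC.
  have xVD : nbhs x (V `\` D n) by exact: open_nbhs_nbhs.
  have [|B xB BVD] := compact_regular hU cK _ xVD.
    exact: filterS VK (open_nbhs_nbhs (conj oV Vx)).
  exists B^° => _; split.
    split; [exact: open_interior|by exists x|].
    by move=> y /interior_subset/subset_closure/BVD [/VK].
  exact: subset_trans (closureS (@interior_subset _ _)) BVD.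
pose V := fix V n := if n is m.+1 then f (m, V m) else K^°.
have goodV n : good (V n).
  elim: n => [|n /(fP (n, _))[]//].
  by split=> //=; [exact: open_interior|exact: interior_subset].
have VS n : closure (V n.+1) `<=` V n `\` D n.
  by have [] := fP (n, V n) (goodV n).
have Vdec n m : (n <= m)%N -> V m `<=` V n.
  move=> /subnK <-; elim: (m - n)%N => // k IH.
  by move=> x /subset_closure/VS [/IH].
(* A cluster point of this filter lies in the closure of every [V n.+1], hence outside every
   [D n]. *)
pose F := filter_from [set: nat] V.
have FF : ProperFilter F.
  apply: filter_from_proper => [|n _]; last by case: (goodV n).
  apply: filter_from_filter; first by exists 0%N.
  by move=> i j _ _; exists (maxn i j) => // x Vx;
    split; apply: Vdec Vx; rewrite ?leq_maxl ?leq_maxr.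
have [|x [Kx clx]] := cK F FF; first by exists 0%N => //; case: (goodV 0%N).
have [n _ Dnx] := KD x Kx.
suff /VS[] : closure (V n.+1) x by [].
by move=> B xB; apply: clx xB; exists n.+1.
Qed.

Lemma DMCso_at_interior (R : realType) (X : finType) (hX : (2 <= #|X|)%N)
    (T : set_system (DMCso R X)) (hT : is_topology T) (n : nat) :
  natural_topology T -> (@DMCso_at R X n : set (topologized hT))^° = set0.
Proof.
move=> natT; rewrite -subset0 => w.
rewrite /interior nbhsE => -[V [oV Vw] VD].
have [W0 wE] := VD w Vw.
(* One extra output makes room for the rank contradiction; [inord] gives it a default value. *)
have fK : cancel (widen_ord (leqnSn n.+1)) (inord : 'I_n.+2 -> 'I_n.+1).
  by move=> i; exact: inord_val.
have [W1 /classo_eqP W01] := equivalent_embedding fK W0.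
have [a [b ab]] : exists a b : X, a != b.
  by move/card_gt1P: hX => [a [b [_ _ ab]]]; exists a, b.
have oA : open (@classo R X n.+1 @^-1` V).
  by move/continuousP: (@classo_continuous R X T hT n.+1 natT); exact.
have [|W VW [W0lt Wneq]] := open_DMC_perturb ab oA.
  by exists W1; rewrite /preimage /= -W01 -wE.
(* [W] degrades to [W3] by [Q] and is recovered by [P], so [compose P Q] fixes [W] while passing
   through only n+1 outputs. *)
have [W3 /classo_eqP[[P WP] [Q WQ]]] := VD _ VW.
have : compose P Q = identity R 'I_n.+2.
  by apply: (compose_fixed _ W0lt Wneq); rewrite -composeA -WQ.
by move/compose_eq_identity_leq; rewrite ltnn.
Qed.

Theorem proposition8 (R : realType) (X : finType) (hX : (2 <= #|X|)%N)
    (T : set_system (DMCso R X)) (hT : is_topology T)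
    (hausT : hausdorff_space (topologized hT))
    (natT : natural_topology T) :
  forall What : topologized hT,
    ~ exists K : set (topologized hT), compact K /\ nbhs What K.
Proof.
move=> What [K [cK KW]].
apply: (@compact_not_meager (topologized hT) K (@DMCso_at R X)) => //.
- by exists What.
- by move=> n; apply: compact_closed => //; exact: DMCso_at_compact.
- by move=> n; exact: DMCso_at_interior.
move=> w _; have [[n W] <-] : exists W : DMCs R X, \pi_(DMCso R X)%qT W = w.
  by exists (repr w); rewrite reprK.
by exists n => //; exists W.
Qed.
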